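(* Let $q=ef+1$ be a prime power with $q\equiv1\pmod4$, $e>2$ even and $f>1$. Let ${C_0^2}'=\{C_0^e,C_2^e,\ldots,C_{e-2}^e\}$. If either (i) $q\equiv1\pmod8$ and $f\equiv2\pmod4$, or (ii) $f\equiv3\pmod4$, then ${C_0^2}'$ is a proper $(q,\frac{e}{2},f,\phi_0,\phi_1)$-disjoint partial difference family and a proper $(q,\frac{e}{2},f,\frac{q-5}{4}-\phi_0,\frac{q-1}{4}-\phi_1)$-external partial difference family.
   Context: $G=(GF(q),+)$, $G^*=G\setminus\{0\}$; $\alpha$ a primitive element; $C_i^d=\alpha^i\langle\alpha^d\rangle$ for $d\mid q-1$ (so $C_0^2$ is the set of nonzero squares). For $i\in\{0,1\}$, $\Phi_i=\{x\in C_0^e:x\neq1,\ x-1\in\alpha^iC_0^2\}$ and $\phi_i=|\Phi_i|$. $\Delta(D)$ is the multiset $\{x-y:x,y\in D,x\neq y\}$, $\Delta(D_1,D_2)$ the multiset $\{x-y:x\in D_1,y\in D_2\}$, $\lambda A$ is $\lambda$ copies of each element of $A$. For a family of $m$ disjoint $k$-subsets $D_i$ of $G^*$ with union $S$: $(q,m,k,\lambda,\mu)$-disjoint (resp. external) partial difference family means $\bigcup_i\Delta(D_i)$ (resp. $\bigcup_{i\neq j}\Delta(D_i,D_j)$) equals $\lambda S+\mu(G^*\setminus S)$; proper means $\lambda\neq\mu$. *)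

(* Defs.v *)
From HB Require Import structures.
From mathcomp Require Import all_boot all_order all_algebra all_fingroup all_solvable.

Set Implicit Arguments.
Unset Strict Implicit.
Unset Printing Implicit Defensive.

Import GRing.Theory.
Local Open Scope ring_scope.

Section Multisets.
Variable F : finFieldType.
Implicit Types D A S : {set F}.

(* Multisets of field elements are sequences compared with perm_eq; the union
   of multisets (adding multiplicities) is concatenation. *)

Definition Delta D : seq F :=
  [seq p.1 - p.2 | p : F * F in [set p in setX D D | p.1 != p.2]].

Definition Delta2 D1 D2 : seq F := [seq p.1 - p.2 | p : F * F in setX D1 D2].

Definition copies (lam : nat) A : seq F := flatten (nseq lam (enum A)).

Definition disjoint_family (m k : nat) (D : 'I_m -> {set F}) : Prop :=
  [/\ forall i, #|D i| = k,
      forall i, D i \subset [set~ 0]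
    & forall i j, i != j -> [disjoint D i & D j]].

Definition two_valued (lam mu : nat) S : seq F :=
  copies lam S ++ copies mu ([set~ 0] :\: S).

Definition dpdf (q m k lam mu : nat) (D : 'I_m -> {set F}) : Prop :=
  [/\ #|F| = q, disjoint_family k D
    & perm_eq (\big[cat/[::]]_(i < m) Delta (D i))
              (two_valued lam mu (\bigcup_(i < m) D i))].

Definition epdf (q m k lam mu : nat) (D : 'I_m -> {set F}) : Prop :=
  [/\ #|F| = q, disjoint_family k D
    & perm_eq (\big[cat/[::]]_(i < m) \big[cat/[::]]_(j < m | i != j)
                 Delta2 (D i) (D j))
              (two_valued lam mu (\bigcup_(i < m) D i))].

Definition proper_dpdf (q m k lam mu : nat) (D : 'I_m -> {set F}) : Prop :=
  dpdf q k lam mu D /\ lam <> mu.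

Definition proper_epdf (q m k lam mu : nat) (D : 'I_m -> {set F}) : Prop :=
  epdf q k lam mu D /\ lam <> mu.

End Multisets.

Arguments proper_dpdf {F} q m k lam mu D.
Arguments proper_epdf {F} q m k lam mu D.

Section Cyclotomy.
Variables (F : finFieldType) (alpha : {unit F}).

Definition primitive_element : bool := generator [set: {unit F}] alpha.

(* C_i^d = alpha^i <alpha^d>, for d dividing #|F| - 1 *)
Definition cyclo (d i : nat) : {set F} :=
  [set (FinRing.uval alpha : F) ^+ i * FinRing.uval x
     | x : {unit F} in <[alpha ^+ d]>%g].

Definition Phi (e i : nat) : {set F} :=
  [set x : F in cyclo e 0 |
     (x != 1) && (x - 1 \in [set (FinRing.uval alpha : F) ^+ i * y
                               | y : F in cyclo 2 0])].

Definition phi (e i : nat) : nat := #|Phi e i|.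

(* The family C_0^e, C_2^e, ..., C_(e-2)^e partitioning C_0^2, for e even *)
Definition even_classes (e : nat) (j : 'I_(e %/ 2)) : {set F} := cyclo e (2 * j).

End Cyclotomy.

(* Main.v *)
Require Import Defs.
From HB Require Import structures.
From mathcomp Require Import all_boot all_order all_algebra all_fingroup all_solvable.
From mathcomp Require Import zify ring.

(** A nonzero [z] is a difference [x - y] of two elements of a common class
    [C_(2j)^e] exactly when [t = x / y] lies in [C_0^e] and [y = z / (t - 1)]
    is a square; so [z] occurs [phi_0] times if it is a square and [phi_1]
    times otherwise.  For [e = 2] the same count gives the multiplicities
    [(q - 5) / 4] and [(q - 1) / 4] of the Paley partial difference set, and
    the external differences are what remains of those.  Properness is a
    parity argument: [t |-> 1 / t] is an involution of [Phi_i], whose only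
    possible fixed point is [-1], and [phi_0 + phi_1 = f - 1]. *)

Set Implicit Arguments.
Unset Strict Implicit.
Unset Printing Implicit Defensive.

Import GRing.Theory.

(** * Parity of a finite set under an involution *)

Lemma odd_card_involution (T : finType) (g : T -> T) (A : {set T}) :
  involutive g -> {in A, forall x, g x \in A} ->
  odd #|A| = odd #|[set x in A | g x == x]|.
Proof.
move=> gK; have [n] := ubnP #|A|; elim: n A => // n IHn A ltAn gA.
case: (pickP [pred x in A | g x != x]) => [x /andP[/= Ax gx]|noA]; last first.
  congr (odd #|pred_of_set _|); apply/setP=> x; rewrite inE.
  by have := noA x; rewrite /=; case: (x \in A) => //= /negbFE ->.
(* The orbit of [x] and [g x] has two elements and no fixed point, so removing it from [A] changes
   neither the parity nor the set of fixed points. *)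
have Agx : g x \in A :\ x by rewrite !inE gx gA.
have cA := cardsD1 x A; have cA' := cardsD1 (g x) (A :\ x).
rewrite Ax in cA; rewrite Agx in cA'.
have -> : [set y in A | g y == y] = [set y in A :\ x :\ g x | g y == y].
  apply/setP=> y; rewrite !inE; case: (eqVneq y (g x)) => [->|] //=.
    by rewrite gK eq_sym (negPf gx) andbF.
  by case: (eqVneq y x) => [->|//]; rewrite (negPf gx) andbF.
rewrite -IHn; first by rewrite cA cA' !oddD /= negbK.
  by lia.
move=> y; rewrite !inE => /and3P[y1 y2 Ay]; rewrite gA // andbT.
by rewrite (inj_eq (can_inj gK)) y2 /=; apply: contraNneq y1 => <-; rewrite gK.
Qed.

(** * Multiplicities in difference multisets *)

Section DifferenceMultiplicities.
Local Open Scope ring_scope.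
Variable F : finFieldType.
Implicit Types A B D S : {set F}.

(** A pair with difference [z] is determined by its second entry. *)
Lemma count_mem_Delta2 A B z :
  count_mem z (Delta2 A B) = #|[set y in B | y + z \in A]|.
Proof.
rewrite /Delta2 /image_mem count_map -size_filter.
rewrite -(size_map snd) -(card_uniqP _); last first.
  rewrite map_inj_in_uniq; first exact: filter_uniq (enum_uniq _).
  move=> -[x y] [x' y'] /=.
  rewrite !mem_filter /= => /andP[/eqP e1 _] /andP[/eqP e2 _] eyy.
  by congr (_, _) => //; rewrite -(subrK y x) e1 -e2 eyy subrK.
apply: eq_card => y; rewrite [in RHS]inE; apply/mapP/andP.
  case=> -[x y'] /=; rewrite mem_filter mem_enum in_setX.
  by case/andP=> /eqP <- /andP[Ax By] ->; rewrite addrC subrK.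
case=> By Ay; exists (y + z, y) => //.
by rewrite mem_filter mem_enum in_setX /= By Ay addrC addKr eqxx.
Qed.

Lemma count_mem_Delta D z :
  count_mem z (Delta D) = if z == 0 then 0%N else count_mem z (Delta2 D D).
Proof.
rewrite /Delta /Delta2 /image_mem /enum_mem !count_map !count_filter.
case: eqP => [->|/eqP z0].
  rewrite -(count_pred0 (Finite.enum (F * F)%type)); apply: eq_count => -[x y] /=.
  by rewrite !inE /= subr_eq0; case: eqP => //=; rewrite andbF.
apply: eq_count => -[x y] /=; rewrite !inE /=.
have [xyz|] //= := eqVneq (x - y) z.
by rewrite -(subr_eq0 x y) xyz z0 andbT.
Qed.

Lemma count_mem_copies n A z : count_mem z (copies n A) = (n * (z \in A))%N.
Proof.
elim: n => [|n IHn] //=; rewrite count_cat IHn mulSn; congr (_ + _)%N.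
by rewrite count_uniq_mem ?enum_uniq // mem_enum.
Qed.

Lemma count_mem_two_valued lam mu S z : 0 \notin S ->
  count_mem z (two_valued lam mu S) =
    if z == 0 then 0%N else if z \in S then lam else mu.
Proof.
move=> S0; rewrite count_cat !count_mem_copies !inE.
case: eqP => [->|_]; first by rewrite (negPf S0) andbF !muln0.
by case: (z \in S); rewrite /= ?muln1 ?muln0 ?addn0.
Qed.

Lemma count_big_cat (T : Type) (I : finType) (P : pred I) (a : pred T)
    (s : I -> seq T) :
  count a (\big[cat/[::]]_(i | P i) s i) = (\sum_(i | P i) count a (s i))%N.
Proof. by apply: (big_morph _ (count_cat a)). Qed.

Lemma sum_card_bigcup (I : finType) (D : I -> {set F}) (P : pred F) :
  (forall i j, i != j -> [disjoint D i & D j]) ->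
  (\sum_i #|[set y in D i | P y]| = #|[set y in \bigcup_i D i | P y]|)%N.
Proof.
move=> dD.
have -> : [set y in \bigcup_i D i | P y] = \bigcup_i [set y in D i | P y].
  apply/setP=> y; rewrite inE; apply/andP/bigcupP.
    by case=> /bigcupP[i _ Diy] Py; exists i; rewrite // inE Diy.
  by case=> i _; rewrite inE => /andP[Diy ->]; split=> //; apply/bigcupP; exists i.
rewrite -[RHS]sum1_card partition_disjoint_bigcup => [|i j /dD].
  by apply: eq_bigr => i _; rewrite sum1_card.
rewrite -!setI_eq0 => /eqP/setP dij; apply/eqP/setP=> y.
have := dij y; rewrite !inE.
by case: (y \in D i); case: (y \in D j); rewrite /= ?andbF.
Qed.

Lemma sum_count_Delta2 (I : finType) (D : I -> {set F}) z :
  (forall i j, i != j -> [disjoint D i & D j]) ->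
  (\sum_i \sum_j count_mem z (Delta2 (D i) (D j)))%N =
  #|[set y in \bigcup_i D i | y + z \in \bigcup_i D i]|.
Proof.
move=> dD; rewrite exchange_big -sum_card_bigcup //=; apply: eq_bigr => j _.
(* For fixed [j], translation by [z] replaces [y] in [D j] by [x = y + z] in [D i]; the counts then
   add up over the disjoint sets [D i]. *)
under eq_bigr => i _.
  rewrite count_mem_Delta2 -(card_imset _ (addIr z)).
  have -> : [set y + z | y in [set y in D j | y + z \in D i]] =
            [set x in D i | x - z \in D j].
    apply/setP=> x; apply/imsetP/idP=> [[y]|]; rewrite inE.
      by case/andP=> Djy Diy ->; rewrite inE Diy addrK.
    by case/andP=> Dix Djx; exists (x - z); rewrite ?subrK // inE subrK Djx.
  over.
rewrite sum_card_bigcup // -[RHS](card_imset _ (addIr z)); apply: eq_card => x.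
rewrite inE; apply/andP/imsetP => [[Dx Djx]|[y]].
  by exists (x - z); rewrite ?subrK // inE subrK Djx.
by rewrite inE => /andP[Djy Dy] ->; rewrite addrK.
Qed.

End DifferenceMultiplicities.

(** * Cyclotomic classes through exponents of [alpha] *)

Section CyclotomicClasses.
Local Open Scope ring_scope.
Variables (F : finFieldType) (alpha : {unit F}).
Hypothesis alpha_gen : primitive_element alpha.
Local Notation a := (FinRing.uval alpha : F).
Local Notation n := (#|F|.-1).

Lemma order_primitive : #[alpha]%g = n.
Proof.
by rewrite -card_finField_unit orderE; move/eqP: alpha_gen => <-.
Qed.

Lemma uval_neq0 (u : {unit F}) : FinRing.uval u != 0 :> F.
Proof. by rewrite -unitfE; apply: valP. Qed.

Lemma primitive_exp_inj k l : (a ^+ k == a ^+ l) = (k == l %[mod n]).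
Proof.
rewrite -!FinRing.val_unitX -order_primitive -eq_expg_mod_order.
exact: (inj_eq val_inj).
Qed.

Lemma neq0_primitive_exp x : x != 0 -> exists k, x = a ^+ k.
Proof.
move=> x0; have ux : x \is a GRing.unit by rewrite unitfE.
have: (FinRing.unit F ux) \in [set: {unit F}] by rewrite inE.
move/eqP: alpha_gen => -> /cycleP[k ek]; exists k.
by rewrite -FinRing.val_unitX -ek.
Qed.

Lemma card_predF_gt0 : (0 < n)%N.
Proof. by rewrite -order_primitive order_gt0. Qed.

Lemma cyclo_neq0 d i x : x \in cyclo alpha d i -> x != 0.
Proof.
case/imsetP=> u _ ->; rewrite mulf_neq0 ?expf_neq0 ?uval_neq0 //.
Qed.

Lemma zero_notin_cyclo d i : (0 \in cyclo alpha d i) = false.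
Proof. by apply/negP=> /cyclo_neq0; rewrite eqxx. Qed.

(** Because [d] divides the order of [alpha], the residue of an exponent modulo [d] depends only on
    the power itself. This turns membership questions into congruences. *)
Lemma mem_cyclo_exp d i k : (d %| n)%N ->
  (a ^+ k \in cyclo alpha d i) = (k == i %[mod d]).
Proof.
move=> dn; apply/imsetP/idP => [[u /cycleP[m ->]]|ki].
  move/eqP; rewrite !FinRing.val_unitX -exprM -exprD primitive_exp_inj => /eqP ek.
  by rewrite -(modn_dvdm k dn) ek modn_dvdm // addnC mulnC modnMDl.
have n0 := card_predF_gt0.
(* Adding [i * n] to the exponent changes neither the power of [a] nor the residue modulo [d], and
   keeps the subtraction of [i] from being truncated. *)
have le_i : (i <= k + i * n)%N by nia.
have : (d %| k + i * n - i)%N.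
  rewrite -eqn_mod_dvd //.
  by case/dvdnP: dn => c ->; rewrite mulnA addnC modnMDl.
case/dvdnP=> m em; exists ((alpha ^+ d) ^+ m)%g; first exact: mem_cycle.
apply/eqP; rewrite !FinRing.val_unitX -exprM -exprD primitive_exp_inj.
by rewrite mulnC -em subnKC // addnC modnMDl.
Qed.

Lemma cyclo0_mulr d i x y : (d %| n)%N -> x \in cyclo alpha d 0 ->
  (y * x \in cyclo alpha d i) = (y \in cyclo alpha d i).
Proof.
move=> dn Cx; have [->|y0] := eqVneq y 0; first by rewrite mul0r.
have [k ek] := neq0_primitive_exp (cyclo_neq0 Cx).
have [l ->] := neq0_primitive_exp y0.
move: Cx; rewrite ek -exprD !mem_cyclo_exp // mod0n => /dvdnP[m ->].
by rewrite addnC modnMDl.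
Qed.

Lemma cyclo0_inv d x : (d %| n)%N ->
  (x^-1 \in cyclo alpha d 0) = (x \in cyclo alpha d 0).
Proof.
move=> dn.
suff im y : y \in cyclo alpha d 0 -> y^-1 \in cyclo alpha d 0.
  by apply/idP/idP=> /im; rewrite ?invrK.
move=> Cy; rewrite -(cyclo0_mulr _ _ dn Cy) mulVf ?(cyclo_neq0 Cy) //.
by rewrite -(expr0 a) mem_cyclo_exp.
Qed.

Lemma cyclo_div d i x y : (d %| n)%N -> y \in cyclo alpha d i ->
  (x / y \in cyclo alpha d 0) = (x \in cyclo alpha d i).
Proof.
move=> dn Cy; have y0 := cyclo_neq0 Cy.
have [->|x0] := eqVneq x 0; first by rewrite mul0r !zero_notin_cyclo.
have [m em] : exists m, x / y = a ^+ m.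
  by apply: neq0_primitive_exp; rewrite mulf_neq0 ?invr_eq0.
have -> : x = a ^+ m * y by rewrite -em mulfVK.
rewrite mulfK //; have [l el] := neq0_primitive_exp y0; move: Cy.
rewrite el -exprD !mem_cyclo_exp // -modnDmr => /eqP ->.
by rewrite modnDmr -{2}[i]add0n eqn_modDr.
Qed.

(** Turns the multiple of the squares used in [Phi] into a class. *)
Lemma cyclo_shift d i : [set a ^+ i * y | y in cyclo alpha d 0] = cyclo alpha d i.
Proof.
apply/setP=> x; apply/imsetP/imsetP=> [[y /imsetP[u Cu ->] ->]|[u Cu ->]].
  by exists u; rewrite // expr0 mul1r.
by exists (FinRing.uval u) => //; apply/imsetP; exists u; rewrite // expr0 mul1r.
Qed.

Lemma mem_Phi e i x :
  (x \in Phi alpha e i) =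
  [&& x \in cyclo alpha e 0, x != 1 & x - 1 \in cyclo alpha 2 i].
Proof. by rewrite inE cyclo_shift. Qed.

Lemma card_cyclo d i : (d %| n)%N -> #|cyclo alpha d i| = (n %/ d)%N.
Proof.
move=> dn; rewrite card_imset; last first.
  by move=> u v /(mulfI (expf_neq0 i (uval_neq0 alpha))) /val_inj.
by rewrite -orderE orderXdiv order_primitive.
Qed.

Lemma cyclo_subset d d' i : (d %| n)%N -> (d' %| d)%N ->
  cyclo alpha d i \subset cyclo alpha d' i.
Proof.
move=> dn dd; apply/subsetP=> x Cx.
have [k ek] := neq0_primitive_exp (cyclo_neq0 Cx).
move: Cx; rewrite ek !mem_cyclo_exp // ?(dvdn_trans dd) // => /eqP ki.
by rewrite -(modn_dvdm k dd) ki modn_dvdm.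
Qed.

(** * Nonsquares and -1 in odd characteristic *)

Section EvenOrder.
Hypothesis n_even : (2 %| n)%N.

Lemma mem_cyclo21 x : x != 0 ->
  (x \in cyclo alpha 2 1) = (x \notin cyclo alpha 2 0).
Proof.
case/neq0_primitive_exp=> k ->; rewrite !mem_cyclo_exp // !modn2.
by case: (odd k).
Qed.

(** The power on the right squares to 1 and is not 1, as its exponent lies strictly between 0 and
    [n]. *)
Lemma opp1_primitive_exp : -1 = a ^+ (n %/ 2).
Proof.
have n0 := card_predF_gt0.
have : (a ^+ (n %/ 2)) ^+ 2 == 1.
  by rewrite -exprM divnK // -(expr0 a) primitive_exp_inj modnn mod0n.
rewrite sqrf_eq1 => /orP[|/eqP //].
rewrite -[X in _ == X](expr0 a) primitive_exp_inj mod0n modn_small; last by lia.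
by move/eqP; lia.
Qed.

Lemma opp1_neq1 : -1 != 1 :> F.
Proof.
have n0 := card_predF_gt0.
rewrite opp1_primitive_exp -[X in _ != X](expr0 a) primitive_exp_inj mod0n.
by rewrite modn_small; lia.
Qed.

End EvenOrder.

(** * The sets [Phi] and their sizes when -1 is a square *)

Section OrderDivisibleByFour.
Hypothesis n4 : (4 %| n)%N.

Let n2 : (2 %| n)%N. Proof. exact: dvdn_trans n4. Qed.

Lemma opp1_square : -1 \in cyclo alpha 2 0.
Proof. by rewrite opp1_primitive_exp // mem_cyclo_exp //; lia. Qed.

Lemma mem_cycloN i x : (- x \in cyclo alpha 2 i) = (x \in cyclo alpha 2 i).
Proof. by rewrite -mulrN1 cyclo0_mulr // opp1_square. Qed.

(** In [1 / x - 1 = - (x - 1) / x] both -1 and [x] are squares, the latter because [e] is even. *)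
Lemma Phi_inv e i x : (e %| n)%N -> (2 %| e)%N ->
  x \in Phi alpha e i -> x^-1 \in Phi alpha e i.
Proof.
move=> en e2; rewrite !mem_Phi => /and3P[Cx x1 Cx1].
have x0 := cyclo_neq0 Cx.
rewrite cyclo0_inv // Cx invr_eq1 x1 /=.
have -> : x^-1 - 1 = - (x - 1) * x^-1 by field.
rewrite cyclo0_mulr ?mem_cycloN // cyclo0_inv //.
by rewrite (subsetP (cyclo_subset 0 en e2)).
Qed.

(** A fixed point of inversion is 1 or -1, and [Phi] excludes 1. *)
Lemma odd_phi e i : (e %| n)%N -> (2 %| e)%N ->
  odd (phi alpha e i) = (-1 \in Phi alpha e i).
Proof.
move=> en e2; rewrite /phi (@odd_card_involution _ (fun x => x^-1)).
- have -> : [set x in Phi alpha e i | x^-1 == x] =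
            if -1 \in Phi alpha e i then [set -1] else set0.
    apply/setP=> x; rewrite inE.
    have -> : (x \in Phi alpha e i) && (x^-1 == x) =
              (-1 \in Phi alpha e i) && (x == -1).
      apply/andP/andP=> [[Px /eqP ex]|[Px /eqP ->]]; last first.
        by rewrite invrN1.
      move: (Px); rewrite mem_Phi => /and3P[/cyclo_neq0 x0 x1 _].
      have /eqP: x ^+ 2 = 1 by rewrite expr2 -{1}ex mulVf.
      by rewrite sqrf_eq1 (negPf x1) /= => /eqP xN; rewrite -xN.
    by case: ifP => _; rewrite inE.
  by case: ifP => _; rewrite ?cards1 ?cards0.
- exact: invrK.
- by move=> x; apply: Phi_inv.
Qed.

(** For [x] in [C_0^e] other than 1, [x - 1] is nonzero, hence either a square or a nonsquare. *)
Lemma phi_add e : (e %| n)%N -> (phi alpha e 0 + phi alpha e 1 = n %/ e - 1)%N.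
Proof.
move=> en; rewrite -(card_cyclo 0 en) (cardsD1 1) -{1}(expr0 a) mem_cyclo_exp //.
rewrite eqxx addKn -(cardsID (Phi alpha e 0) (_ :\ _)); congr (_ + _)%N.
  apply: eq_card => x; rewrite in_setI mem_Phi in_setD1.
  by case: (x \in cyclo _ _ _); case: (x == 1).
apply: eq_card => x; rewrite in_setD !mem_Phi in_setD1.
case: (x \in cyclo _ _ _) => //=; rewrite ?andbF //.
have [|x1] /= := eqVneq x 1; first by [].
by rewrite mem_cyclo21 ?andbT // subr_eq0.
Qed.

(* With [N] the nonsquares, [x |-> 1 - x] maps [Phi 2 1] onto the [x] in [N]
   with [x - 1] a square, and [x |-> 1 / x] maps those onto the [x] in [N] with
   [x - 1] in [N]. *)
Lemma phi2_1 : phi alpha 2 1 = (n %/ 4)%N.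
Proof.
pose N i := [set x in cyclo alpha 2 1 | x - 1 \in cyclo alpha 2 i].
have cN : (#|N 0%N| + #|N 1%N| = n %/ 2)%N.
  rewrite -(card_cyclo 1 n2) -(cardsID (N 0%N) (cyclo _ _ _)); congr (_ + _)%N.
    by apply: eq_card => x; rewrite !inE; case: (x \in cyclo _ _ _).
  apply: eq_card => x; rewrite !inE.
  case Cx: (x \in cyclo _ _ 1); rewrite ?andbF //= andbT mem_cyclo21 //.
  rewrite subr_eq0; apply: contraTneq Cx => ->.
  by rewrite -(expr0 a) mem_cyclo_exp.
have c10 : phi alpha 2 1 = #|N 0%N|.
  have inj : injective (fun x : F => 1 - x) by move=> x y /addrI/oppr_inj.
  rewrite /phi -(card_imset _ inj); apply: eq_card => x; rewrite inE.
  apply/imsetP/andP=> [[y]|[Nx Sx]].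
    rewrite mem_Phi => /and3P[Sy y1 Ny] ->; rewrite -mem_cycloN opprB.
    by rewrite addrAC subrr add0r mem_cycloN.
  exists (1 - x); last by rewrite opprB addrC subrK.
  rewrite mem_Phi -mem_cycloN opprB Sx addrAC subrr add0r mem_cycloN Nx andbT.
  rewrite -subr_eq0 addrAC subrr add0r oppr_eq0.
  exact: cyclo_neq0 Nx.
have inv1 (x : F) : (x^-1 \in cyclo alpha 2 1) = (x \in cyclo alpha 2 1).
  have [->|x0] := eqVneq x 0; first by rewrite invr0.
  by rewrite !mem_cyclo21 ?invr_eq0 // cyclo0_inv.
have c01 : #|N 0%N| = #|N 1%N|.
  have invE (x : F) : x \in cyclo alpha 2 1 -> x != 1 ->
      (x^-1 - 1 \in cyclo alpha 2 1) = (x - 1 \in cyclo alpha 2 0).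
    move=> Nx x1; have x0 := cyclo_neq0 Nx.
    have -> : x^-1 - 1 = - ((x - 1) / x) by field.
    rewrite mem_cycloN mem_cyclo21 ?mulf_neq0 ?invr_eq0 ?subr_eq0 //.
    by rewrite (cyclo_div _ n2 Nx) mem_cyclo21 ?subr_eq0 // negbK.
  have neq1 (x : F) : x \in cyclo alpha 2 1 -> x != 1.
    by apply: contraTneq => ->; rewrite -(expr0 a) mem_cyclo_exp.
  rewrite -(card_imset _ (@invr_inj F)); apply: eq_card => x; rewrite inE.
  apply/imsetP/andP=> [[y]|[Nx Nx1]].
    by rewrite inE => /andP[Ny Sy] ->; rewrite inv1 invE // neq1.
  exists x^-1; rewrite ?invrK // inE inv1 Nx -invE ?invrK ?inv1 //.
  by rewrite neq1 // inv1.
by rewrite c10; lia.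
Qed.

Lemma phi2_0 : phi alpha 2 0 = ((n - 4) %/ 4)%N.
Proof. by have := phi_add n2; rewrite phi2_1; have := card_predF_gt0; lia. Qed.

(** Follows from the inclusion of [C_0^e] in the squares; it keeps the external multiplicities from
    being truncated differences. *)
Lemma phi_le_phi2 e i : (e %| n)%N -> (2 %| e)%N ->
  (phi alpha e i <= phi alpha 2 i)%N.
Proof.
move=> en e2; apply/subset_leq_card/subsetP=> x; rewrite !mem_Phi.
by case/and3P=> /(subsetP (cyclo_subset 0 en e2)) -> -> ->.
Qed.

(** The map [y |-> (y + z) / y = 1 + z / y] is injective with inverse [t |-> z / (t - 1)], and [y]
    is a square exactly when [t - 1] has the quadratic character of [z]. The boolean, read as 0 or
    1, is the index of the quadratic class of [z]. *)
Lemma card_square_translate e z : (e %| n)%N -> z != 0 ->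
  #|[set y in cyclo alpha 2 0 | (y + z) / y \in cyclo alpha e 0]| =
  phi alpha e (z \notin cyclo alpha 2 0).
Proof.
move=> en z0; set i : nat := (z \notin _).
have Cz : z \in cyclo alpha 2 i.
  by rewrite /i; case Sz: (z \in cyclo _ _ 0); rewrite //= mem_cyclo21 ?Sz.
rewrite /phi -(card_in_imset (f := fun y => (y + z) / y)) => [|x y]; last first.
  rewrite !inE => /andP[/cyclo_neq0 x0 _] /andP[/cyclo_neq0 y0 _].
  by rewrite !mulrDl !divff // => /addrI /(mulfI z0) /invr_inj.
apply: eq_card => t; rewrite mem_Phi; apply/imsetP/and3P=> [[y]|[Ct t1 Ct1]].
  rewrite inE => /andP[Sy Cy] ->; have y0 := cyclo_neq0 Sy.
  rewrite Cy mulrDl divff // -subr_eq0 addrAC subrr add0r.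
  by rewrite mulf_neq0 ?invr_eq0 // cyclo0_mulr // cyclo0_inv.
have t10 : t - 1 != 0 by rewrite subr_eq0.
exists (z / (t - 1)); last by field; rewrite z0 t10.
rewrite inE (cyclo_div _ n2 Ct1) Cz /=.
by have -> : (z / (t - 1) + z) / (z / (t - 1)) = t by field; rewrite z0 t10.
Qed.

(** * The family of even-indexed classes and its differences *)

Section EvenClasses.
Variable e : nat.
Hypotheses (e_n : (e %| n)%N) (e_even : (2 %| e)%N).
Local Notation D := (even_classes alpha (e := e)).

Lemma even_classes_disjoint i j : i != j -> [disjoint D i & D j].
Proof.
move=> nij; rewrite -setI_eq0; apply/eqP/setP=> x; rewrite !inE.
apply: contraNF nij => /andP[Cx]; have [k ek] := neq0_primitive_exp (cyclo_neq0 Cx).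
move: Cx; rewrite ek /even_classes !mem_cyclo_exp // => /eqP -> /eqP.
have := ltn_ord i; have := ltn_ord j => lj li.
(* The indices [2 * i] and [2 * j] are below [e], so congruence modulo [e] is equality. *)
rewrite !modn_small; [by move=> ij; apply/eqP/val_inj => /=; lia|lia|lia].
Qed.

Lemma bigcup_even_classes : \bigcup_i D i = cyclo alpha 2 0.
Proof.
have e0 : (0 < e)%N by apply: dvdn_gt0 e_n; apply: card_predF_gt0.
apply/setP=> x; have [->|x0] := eqVneq x 0.
  by rewrite zero_notin_cyclo; apply/negP=> /bigcupP[i _]; rewrite zero_notin_cyclo.
have [k ->] := neq0_primitive_exp x0; rewrite mem_cyclo_exp //.
apply/bigcupP/idP=> [[i _]|k2].
  rewrite mem_cyclo_exp // => /eqP ki.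
  by rewrite -(modn_dvdm k e_even) ki modn_dvdm // mulnC modnMl.
(* An even exponent [k] has even residue modulo [e]; half of that residue indexes its class. *)
have lt : ((k %% e) %/ 2 < e %/ 2)%N by rewrite ltn_divLR // divnK // ltn_mod.
exists (Ordinal lt) => //; rewrite mem_cyclo_exp //= mulnC divnK ?modn_mod //.
by rewrite /dvdn modn_dvdm // (eqP k2).
Qed.

Lemma even_classes_family : disjoint_family (n %/ e) D.
Proof.
split=> [i|i|]; first exact: card_cyclo.
  by apply/subsetP=> x /cyclo_neq0; rewrite !inE.
exact: even_classes_disjoint.
Qed.

(** For [y] in [D i], the condition that [y + z] lies in [D i] says that [(y + z) / y] is in
    [C_0^e]. This no longer mentions [i], so the sum becomes a count over all squares [y]. *)
Lemma sum_internal z : z != 0 ->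
  (\sum_i count_mem z (Delta2 (D i) (D i)) =
   phi alpha e (z \notin cyclo alpha 2 0))%N.
Proof.
move=> z0; rewrite -card_square_translate // -bigcup_even_classes.
rewrite -sum_card_bigcup; last exact: even_classes_disjoint.
apply: eq_bigr => i _; rewrite count_mem_Delta2; apply: eq_card => y.
by rewrite !inE; case Dy: (y \in D i) => //=; rewrite (cyclo_div _ e_n Dy).
Qed.

(** All ordered pairs of classes together yield the differences of the set of squares, which is the
    same count with 2 in place of [e]. *)
Lemma sum_all z : z != 0 ->
  (\sum_i \sum_j count_mem z (Delta2 (D i) (D j)) =
   phi alpha 2 (z \notin cyclo alpha 2 0))%N.
Proof.
move=> z0; rewrite sum_count_Delta2; last exact: even_classes_disjoint.
rewrite -card_square_translate // bigcup_even_classes; apply: eq_card => y.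
by rewrite !inE; case Sy: (y \in cyclo _ _ _) => //=; rewrite (cyclo_div _ n2 Sy).
Qed.

Lemma even_classes_dpdf :
  dpdf #|F| (n %/ e) (phi alpha e 0) (phi alpha e 1) D.
Proof.
split=> //; first exact: even_classes_family.
apply/allP=> z _; apply/eqP; rewrite bigcup_even_classes count_big_cat.
rewrite count_mem_two_valued ?zero_notin_cyclo //.
under eq_bigr do rewrite count_mem_Delta.
case: eqP => [_|/eqP z0]; first by rewrite big1.
by rewrite sum_internal //; case: (z \in _).
Qed.

Lemma even_classes_epdf :
  epdf #|F| (n %/ e) (phi alpha 2 0 - phi alpha e 0)
    (phi alpha 2 1 - phi alpha e 1) D.
Proof.
split=> //; first exact: even_classes_family.
apply/allP=> z _; apply/eqP; rewrite bigcup_even_classes count_big_cat.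
under eq_bigr do rewrite count_big_cat.
rewrite count_mem_two_valued ?zero_notin_cyclo //.
case: eqP => [->|/eqP z0].
  (* Zero is never an external difference, since distinct classes are disjoint. *)
  apply: big1 => i _; apply: big1 => j /even_classes_disjoint.
  rewrite -setI_eq0 => /eqP dij; rewrite count_mem_Delta2; apply/eqP.
  rewrite cards_eq0 -dij; apply/eqP/setP=> y.
  by rewrite !inE addr0 andbC.
(* Splitting off the diagonal [i = j] leaves the external differences as total minus internal. *)
have := sum_all z0; under eq_bigr => i _ do rewrite (bigD1 i) //=.
rewrite big_split /= sum_internal //.
under [X in (_ + X)%N = _]eq_bigr do under eq_bigl do rewrite eq_sym.
by move=> tot; have := phi_le_phi2 (z \notin cyclo alpha 2 0) e_n e_even;
  case: (z \in _) tot => /= tot _; rewrite -tot addKn.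
Qed.

End EvenClasses.

(* A primitive eighth root of unity [w] satisfies [(w + 1 / w) ^ 2 = 2]. *)
Lemma two_square : (8 %| n)%N -> 2%:R \in cyclo alpha 2 0.
Proof.
move=> n8; pose w := a ^+ (n %/ 8).
have w0 : w != 0 by rewrite expf_neq0 ?uval_neq0.
have w4 : w ^+ 4 = -1 by rewrite -exprM opp1_primitive_exp //; congr (_ ^+ _); lia.
have sq : (w + w^-1) ^+ 2 = 2%:R.
  apply: (mulfI (expf_neq0 2 w0)); apply/eqP; rewrite -subr_eq0.
  have -> : w ^+ 2 * (w + w^-1) ^+ 2 - w ^+ 2 * 2%:R = w ^+ 4 + 1 by field.
  by rewrite w4 addNr.
have two0 : 2%:R != 0 :> F.
  by have := opp1_neq1 n2; rewrite eq_sym -addr_eq0 -natr1 mulr1n.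
have wV0 : w + w^-1 != 0.
  by apply: contraNneq two0 => s0; rewrite -sq s0 expr0n.
have [k ek] := neq0_primitive_exp wV0.
by rewrite -sq ek -exprM mem_cyclo_exp // modnMl mod0n.
Qed.

End OrderDivisibleByFour.

End CyclotomicClasses.

(** * Assembly of both families and properness *)

Theorem theorem5p7 (F : finFieldType) (alpha : {unit F}) (q e f : nat)
  (hF : #|F| = q)
  (halpha : primitive_element alpha)
  (hq : q = e * f + 1)
  (hq4 : q = 1 %[mod 4])
  (he2 : 2 < e) (he : ~~ odd e) (hf : 1 < f)
  (hcases : (q = 1 %[mod 8] /\ f = 2 %[mod 4]) \/ f = 3 %[mod 4]) :
  [/\ proper_dpdf q (e %/ 2) f (phi alpha e 0) (phi alpha e 1)
                  (even_classes alpha (e := e)),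
      (* the two subtractions below are genuine, not truncated *)
      phi alpha e 0 <= (q - 5) %/ 4,
      phi alpha e 1 <= (q - 1) %/ 4
    & proper_epdf q (e %/ 2) f ((q - 5) %/ 4 - phi alpha e 0)
                      ((q - 1) %/ 4 - phi alpha e 1)
                  (even_classes alpha (e := e))].
Proof.
have n_def : #|F|.-1 = (e * f)%N by rewrite hF hq addn1.
have e_n : e %| #|F|.-1 by rewrite n_def dvdn_mulr.
have e_even : 2 %| e by rewrite dvdn2.
have n4 : 4 %| #|F|.-1 by rewrite n_def; lia.
have n2 : 2 %| #|F|.-1 by apply: dvdn_trans n4.
have nf : #|F|.-1 %/ e = f by rewrite n_def mulKn //; lia.
have p20 : phi alpha 2 0 = (q - 5) %/ 4.
  by rewrite phi2_0 // n_def hq; congr (_ %/ _); lia.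
have p21 : phi alpha 2 1 = (q - 1) %/ 4.
  by rewrite phi2_1 // n_def hq; congr (_ %/ _); lia.
have le0 := phi_le_phi2 halpha 0 e_n e_even.
have le1 := phi_le_phi2 halpha 1 e_n e_even.
have sum_phi := phi_add halpha n4 e_n; rewrite nf in sum_phi.
have odd0 := odd_phi halpha n4 0 e_n e_even.
have odd1 := odd_phi halpha n4 1 e_n e_even.
have dp := even_classes_dpdf halpha n4 e_n e_even.
have ep := even_classes_epdf halpha n4 e_n e_even.
rewrite nf hF in dp ep; rewrite p20 p21 in ep le0 le1.
(* Since [(q - 1) / 4] exceeds [(q - 5) / 4] by 1, the external multiplicities agree only if
   [phi_1 = phi_0 + 1]. *)
suff [ne0 ne1] : phi alpha e 0 <> phi alpha e 1 /\
                 (phi alpha e 0).+1 <> phi alpha e 1.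
  by split=> //; split=> //; lia.
case: hcases => [[q8 f2]|f3].
  have n8 : 8 %| #|F|.-1 by rewrite n_def; lia.
  (* Here [phi_0] is odd and the sum [f - 1] is 1 modulo 4: equal values would make the sum even,
     and [phi_1 = phi_0 + 1] would make it 3 modulo 4. Membership of -1 needs [-1 - 1 = -2] to be a
     square, hence the use of 2. *)
  suff mN : (-1)%R \in Phi alpha e 0 by rewrite mN in odd0; split; lia.
  rewrite mem_Phi (opp1_neq1 halpha n2) /= -opprD mem_cycloN //.
  rewrite (two_square halpha n4 n8) andbT.
  rewrite (opp1_primitive_exp halpha n2) mem_cyclo_exp // mod0n n_def.
  have -> : f = (f %/ 2 * 2)%N by lia.
  by rewrite mulnA mulnK // modnMr.
(* If [e] divided the exponent [e * f / 2] of -1, then [f] would be even. *)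
have mN : (-1)%R \notin cyclo alpha e 0.
  rewrite (opp1_primitive_exp halpha n2) mem_cyclo_exp // mod0n n_def.
  apply/negP=> /dvdnP[m em].
  have : e * f = e * (m * 2) by rewrite mulnA [e * m]mulnC -em divnK // -n_def.
  by move/eqP; rewrite eqn_pmul2l; lia.
rewrite mem_Phi (negPf mN) /= in odd0; rewrite mem_Phi (negPf mN) /= in odd1.
(* Both sizes are even with sum 2 modulo 4, so they are neither equal nor consecutive. *)
by split; lia.
Qed.
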